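(* There is an absolute constant $c>0$ such that for every $d\in\mathbb N^+$ and every sufficiently large $n\ge d$ (how large may depend on $d$), there exist a space of examples $\mathcal X$, a hypothesis class $\mathcal H$ over $\mathcal X$ with VC dimension $d$, and a set $S\subseteq\mathcal X$ of $n$ examples such that the following holds. For every region query family $Q$ over $\mathcal X$ with VC dimension at most $(d-2)/3$ and every (possibly randomized) active learning algorithm $\mathcal A$ there is a true hypothesis $h^*\in\mathcal H$ such that, if $\mathcal A$ makes fewer than $n^{c}$ (i.e. fewer than $\mathrm{poly}(n)$) region queries from $Q$, then with probability at least $1/3$ some example $x\in S$ is labeled incorrectly by $\mathcal A$. This holds even when $\mathcal A$ knows that the labeling domain is $L=S$.
   Context: Region-query model. $\mathcal X$ is a set (the example space). A hypothesis class $\mathcal H$ is a set of functions $h:\mathcal X\to\{\pm1\}$. An unknown target $h^*\in\mathcal H$ labels the examples. A region query is a pair $(T,z)$ with $T\subseteq\mathcal X$ and $z\in\{\pm1\}$. A region query family $Q$ is a set of region queries; $\mathrm{dom}(Q)=\{T : (T,z)\in Q \text{ for some } z\}$ and the VC dimension of $Q$ is the VC dimension of the set family $\mathrm{dom}(Q)$. Given a finite dataset $S\subseteq\mathcal X$ and a labeling domain $L$ with $S\subseteq L\subseteq\mathcal X$, the labeler answers a query $(T,z)$ with $q(T,z)=1$ if $h^*(x)=z$ for all $x\in T\cap L$ and $q(T,z)=0$ otherwise; if $T\cap L=\emptyset$ the answer may be arbitrary. A learner is given $\mathcal H$, $S$, $Q$ (not $h^*$), adaptively submits queries from $Q$ based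 on the answers received so far (possibly using internal randomness, over which probabilities are taken), and finally outputs a label for each example of $S$. *)

(* Defs.v *)
From HB Require Import structures.
From mathcomp Require Import all_boot all_order all_algebra.
From mathcomp Require Import all_classical all_reals all_analysis.

Set Implicit Arguments.
Unset Strict Implicit.
Unset Printing Implicit Defensive.

Import Order.TTheory GRing.Theory Num.Theory.
Local Open Scope classical_set_scope.
Local Open Scope card_scope.
Local Open Scope ring_scope.

Definition shatters (X : Type) (F : set (set X)) (A : set X) : Prop :=
  forall B : set X, B `<=` A -> exists2 T, F T & T `&` A = B.

(* Extended-real valued: -oo for the empty family, +oo when finite sets of
   unbounded size are shattered. *)
Definition vcdim (R : realType) (X : Type) (F : set (set X)) : \bar R :=
  ereal_sup [set (k%:R)%:E |
    k in [set k : nat | exists2 A : set X, A #= `I_k & shatters F A]].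

(* Labels are booleans: true stands for +1, false for -1. *)
Definition hypothesis (X : Type) : Type := X -> bool.

Definition positive_regions (X : Type) (H : set (hypothesis X)) :
    set (set X) :=
  [set [set x | h x = true] | h in H].

Definition region_query (X : Type) : Type := (set X * bool)%type.

Definition qdom (X : Type) (Q : set (region_query X)) : set (set X) :=
  [set T | exists z, Q (T, z)].

(* The answer to a query whose region misses the labeling domain L carries no
   information on the target: it is given by e, which does not depend on h. *)
Definition answer (X : Type) (L : set X) (e : region_query X -> bool)
    (h : hypothesis X) (q : region_query X) : bool :=
  if `[< q.1 `&` L = set0 >] then e q
  else `[< forall x, (q.1 `&` L) x -> h x = q.2 >].

(* A deterministic adaptive learner is a decision tree; each run ends with a
   labeling, of which only the values on the dataset matter. *)
Inductive learner (X : Type) (Q : set (region_query X)) : Type :=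
| Output of hypothesis X
| Ask q of Q q & (bool -> learner Q).

Section Run.
Variables (X : Type) (Q : set (region_query X)) (ans : region_query X -> bool).

Fixpoint predict (t : learner Q) : hypothesis X :=
  match t with
  | Output g => g
  | Ask q _ next => predict (next (ans q))
  end.

Fixpoint nqueries (t : learner Q) : nat :=
  match t with
  | Output _ => 0%N
  | Ask q _ next => (nqueries (next (ans q))).+1
  end.

End Run.

(* The randomized learner A draws a seed w and then runs the tree A w. *)
Definition error_event (X Omega : Type) (Q : set (region_query X)) (S L : set X)
    (e : region_query X -> bool) (A : Omega -> learner Q) (h : hypothesis X) :
    set Omega :=
  [set w | exists2 x, S x & predict (answer L e h) (A w) x <> h x].

(* Main.v *)
(* Over a field with q elements, q = 2^m and q^2 <= n < 4q^2, the curves are the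
   graphs of the polynomials of degree < d - 1; the class consists of the curves
   and of the curves with one point removed.  Two curves share at most d - 2
   points, which bounds the VC dimension by d.  If Q has VC dimension
   k <= (d - 2)/3, then Q has at most (n + 1)^k regions by Sauer-Shelah, fewer
   than the q^(d-1) curves, whereas a region with at least d - 1 points lies on
   at most one curve.  So some curve C contains no region with d - 1 points or
   more, and then each query separates C from its puncture at x for fewer than d
   of the points x: fewer than n^(1/4) queries leave most of the q > sqrt(n)/2
   punctures indistinguishable from C. *)
Require Import Defs.
From HB Require Import structures.
From mathcomp Require Import all_boot all_order all_algebra.
From mathcomp Require Import all_field zify.
From mathcomp Require Import all_classical all_reals all_analysis.
From mathcomp Require Import measurable_realfun.

Set Implicit Arguments.
Unset Strict Implicit.
Unset Printing Implicit Defensive.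

Import Order.TTheory GRing.Theory Num.Theory.
Local Open Scope ring_scope.

(** * Shattering on a finite type and the Sauer-Shelah count *)

Section Shattering.
Variable T : finType.
Implicit Types (F : {set {set T}}) (A B C : {set T}).

Definition shattered F A : bool :=
  [forall B : {set T}, (B \subset A) ==> [exists C in F, C :&: A == B]].

Lemma shatteredP F A :
  reflect (forall B, B \subset A -> exists2 C, C \in F & C :&: A = B)
          (shattered F A).
Proof.
apply: (iffP forallP) => [sh B BA | sh B].
  have /exists_inP[C FC /eqP CA] := implyP (sh B) BA.
  by exists C.
apply/implyP => /sh[C FC CA]; apply/exists_inP.
by exists C => //; rewrite CA.
Qed.

Lemma shatteredS F F' A : F \subset F' -> shattered F A -> shattered F' A.
Proof.
move=> /fintype.subsetP sF /shatteredP sh; apply/shatteredP => B /sh[C FC CA].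
by exists C => //; apply: sF.
Qed.

(* Pajor's form of the Sauer-Shelah lemma: split F by membership of a point x;
   a set A shattered by both halves accounts for both A and x |: A. *)
Lemma leq_card_shattered F : (#|F| <= #|[set A | shattered F A]|)%N.
Proof.
elim: {F}_.+1 {-2}F (ltnSn #|F|) => // m IH F leFm.
have [F_le1 | F_gt1] := leqP #|F| 1.
  case: (finset.set_0Vmem F) => [->|[C FC]]; first by rewrite cards0.
  apply: leq_trans F_le1 _; rewrite card_gt0; apply/finset.set0Pn; exists finset.set0.
  rewrite inE; apply/shatteredP => B; rewrite finset.subset0 => /eqP ->.
  by exists C; rewrite // finset.setI0.
(* Two distinct members of [F] differ at some [x]; splitting there leaves both halves nonempty,
   hence both smaller than [F]. *)
have [x /andP[/finset.set0Pn[C1 C1x] /finset.set0Pn[C0 C0x]]] : exists x,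
    ([set C in F | x \in C] != finset.set0) && ([set C in F | x \notin C] != finset.set0).
  have [C [D [FC FD]]] : exists C D, [/\ C \in F, D \in F & C != D].
    by have /card_gt1P[C [D [FC FD nCD]]] := F_gt1; exists C, D.
  rewrite finset.eqEsubset negb_and => /orP[] /fintype.subsetPn[x xC xD]; exists x;
    apply/andP; split; apply/finset.set0Pn.
  - by exists C; rewrite inE FC.
  - by exists D; rewrite inE FD.
  - by exists D; rewrite inE FD.
  - by exists C; rewrite inE FC.
set F1 := [set C in F | x \in C] in C1x; set F0 := [set C in F | x \notin C] in C0x.
have cardF : #|F| = (#|F1| + #|F0|)%N.
  rewrite -cardsUI (_ : F1 :&: F0 = finset.set0) ?cards0 ?addn0; last first.
    by apply/setP => C; rewrite !inE; case: (x \in C); rewrite ?andbF.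
  by congr #|pred_of_set _|; apply/setP => C; rewrite !inE -andb_orr orbN andbT.
have F1_gt0 : (0 < #|F1|)%N by rewrite card_gt0; apply/finset.set0Pn; exists C1.
have F0_gt0 : (0 < #|F0|)%N by rewrite card_gt0; apply/finset.set0Pn; exists C0.
have /IH le1 : (#|F1| < m)%N by lia.
have /IH le0 : (#|F0| < m)%N by lia.
have sF1 : F1 \subset F by apply/fintype.subsetP => C; rewrite inE => /andP[].
have sF0 : F0 \subset F by apply/fintype.subsetP => C; rewrite inE => /andP[].
set S1 := [set A | shattered F1 A] in le1; set S0 := [set A | shattered F0 A] in le0.
(* [x] lies in every member of [F1] and in no member of [F0], so neither half shatters a set
   containing [x]. Hence adding [x] is injective on [S1 :&: S0] and yields sets outside
   [S1 :|: S0]. *)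
have nx1 A : A \in S1 -> x \notin A.
  rewrite inE => /shatteredP sh; apply/negP => xA.
  have [C] := sh finset.set0 (finset.sub0set _); rewrite inE => /andP[_ xC] /setP/(_ x).
  by rewrite !inE xC xA.
have nx0 A : A \in S0 -> x \notin A.
  rewrite inE => /shatteredP sh; apply/negP => xA.
  have [C] := sh A (subxx _); rewrite inE => /andP[_ xC] /setP/(_ x).
  by rewrite !inE (negPf xC) xA.
pose S2 := [set x |: A | A in S1 :&: S0].
have cardS2 : #|S2| = #|S1 :&: S0|.
  apply: card_in_imset => A B; rewrite !inE => /andP[A1 _] /andP[B1 _] eqAB.
  have xA : x \notin A by apply: nx1; rewrite inE.
  have xB : x \notin B by apply: nx1; rewrite inE.
  by rewrite -(finset.setU1K xA) -(finset.setU1K xB) eqAB.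
have dis : (S1 :|: S0) :&: S2 = finset.set0.
  apply/setP => B; rewrite !inE; apply/negP => /andP[S10 /imsetP[A _ eB]].
  have : x \notin B.
    by case/orP: S10 => sh; [apply: nx1 | apply: nx0]; rewrite inE.
  by rewrite eB finset.setU11.
apply: (@leq_trans #|(S1 :|: S0) :|: S2|).
  by rewrite cardF; have := cardsUI (S1 :|: S0) S2; rewrite dis cards0 cardS2;
     have := cardsUI S1 S0; lia.
apply: subset_leq_card; apply/fintype.subsetP => B; rewrite finset.in_setU => /orP[|].
  by rewrite !inE => /orP[]; exact: shatteredS.
case/imsetP => A; rewrite finset.in_setI => /andP[A1 A0] ->{B}.
have xA := nx1 _ A1; move: A1 A0; rewrite !inE => /shatteredP sh1 /shatteredP sh0.
apply/shatteredP => B sB.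
have sBA : B :\ x \subset A by rewrite finset.subDset.
(* The trace [B] on [x |: A] is realised inside the half that agrees with [B] at [x]. *)
have [xB | xB] := boolP (x \in B).
- have [C] := sh1 _ sBA; rewrite inE => /andP[FC xC] CA; exists C => //.
  by rewrite finset.setIUr CA (finset.setIidPr _) ?finset.sub1set // finset.setD1K.
- have [C] := sh0 _ sBA; rewrite inE => /andP[FC xC] CA; exists C => //.
  apply/setP => y; move/setP/(_ y): CA; rewrite !inE.
  by case: eqVneq => [-> | _] //=; rewrite (negPf xC) (negPf xB).
Qed.

(** A set of at most [k] elements is listed by a map from ['I_k] to [option T], with [None] as
    padding, and is recovered from the image of that map. *)
Lemma card_small_sets k : (#|[set A : {set T} | (#|A| <= k)%N]| <= #|T|.+1 ^ k)%N.
Proof.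
rewrite -card_option -{2}(card_ord k) -card_ffun.
pose im (f : {ffun 'I_k -> option T}) := [set x | Some x \in codom f].
apply: leq_trans (leq_imset_card im _).
apply: subset_leq_card; apply/fintype.subsetP => A; rewrite inE => leAk.
apply/imsetP; exists [ffun i : 'I_k => nth None (map Some (enum A)) i] => //.
apply/setP => x; rewrite inE; apply/idP/codomP => [xA | [i]].
  have lt : (index x (enum A) < k)%N.
    by apply: leq_trans leAk; rewrite cardE index_mem mem_enum.
  exists (Ordinal lt); rewrite ffunE /= (nth_map x) ?index_mem ?mem_enum //.
  by rewrite nth_index ?mem_enum.
rewrite ffunE; have [lt | ge] := ltnP i (size (enum A)); last first.
  by rewrite nth_default ?size_map.
by rewrite (nth_map x) // => -[->]; rewrite -mem_enum mem_nth.
Qed.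

End Shattering.

(** * Graphs of polynomials over a finite field *)

Section Graphs.
Variables (F : finFieldType) (r : nat) (X : finType) (j : F * F -> X).
Hypothesis inj_j : injective j.

(** Row vectors encode the polynomials of degree less than [r] as a finite type with [#|F| ^ r]
    elements. The embedding [j] allows [X] to have points off the plane. *)
Definition graph (f : 'rV[F]_r) : {set X} :=
  [set j (u, (rVpoly f).[u]) | u : F].

Lemma card_graph f : #|graph f| = #|F|.
Proof. by rewrite card_imset // => u v /inj_j[]. Qed.

(** The abscissas of common points are roots of the difference, which has degree less than [r] and
    so vanishes once it has [r] roots. *)
Lemma eq_graph f g : (r <= #|graph f :&: graph g|)%N -> f = g.
Proof.
move=> le_r; apply: (can_inj rVpolyK); apply/eqP; rewrite -subr_eq0.
apply: contraLR le_r => nz; rewrite -ltnNge.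
pose U := [set u : F | (rVpoly f).[u] == (rVpoly g).[u]].
have leU : (#|graph f :&: graph g| <= #|U|)%N.
  apply: leq_trans (leq_imset_card (fun u => j (u, (rVpoly f).[u])) _).
  apply: subset_leq_card; apply/fintype.subsetP => x; rewrite inE.
  case/andP => /imsetP[u _ ->] /imsetP[v _ /inj_j[uv euv]].
  by apply: finset.imset_f; rewrite inE euv uv.
apply: leq_ltn_trans leU _; rewrite cardE.
have szp : (size (rVpoly f - rVpoly g)%R <= r)%N.
  by rewrite (leq_trans (size_polyD _ _)) // size_polyN geq_max !size_poly.
apply: leq_trans szp; apply: max_poly_roots (enum_uniq _) => //.
apply/allP => u; rewrite mem_enum inE => /eqP e.
by rewrite /root !hornerE e subrr.
Qed.

(** The product of the ['X - u%:P] over [U] vanishes exactly on [U], and its degree [#|U|] is less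
    than [r]. *)
Lemma exists_graph (U V : {set F}) :
  (#|U| < r)%N -> [disjoint U & V] ->
  exists f, [/\ forall u, u \in U -> j (u, 0) \in graph f &
                forall v, v \in V -> j (v, 0) \notin graph f].
Proof.
move=> ltU dUV; pose p := \prod_(u in U) ('X - u%:P).
have szp : (size p <= r)%N.
  by rewrite /p -big_enum /= size_prod_XsubC -cardE.
have rt u : root p u = (u \in U).
  by rewrite /p -big_enum /= root_prod_XsubC mem_enum.
exists (poly_rV p); split=> [u Uu | v Vv].
  apply/imsetP; exists u => //; rewrite poly_rV_K //.
  by move: (rt u); rewrite Uu /root => /eqP ->.
apply/imsetP => -[u _ /inj_j[<-]]; rewrite poly_rV_K // => e.
have: v \in U by rewrite -rt /root -e.
by rewrite (disjointFl dUV Vv).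
Qed.

End Graphs.

Local Open Scope classical_set_scope.
Local Open Scope card_scope.
Local Open Scope ring_scope.

(** * VC dimension over a finite example space *)

Section FiniteSets.
Variable X : finType.
Implicit Types (A : set X) (B : {set X}).

Definition finset_of A : {set X} := [set x | `[< A x >]]%SET.

Lemma finset_ofK A : [set` finset_of A] = A.
Proof. by apply/seteqP; split=> x /=; rewrite inE => /asboolP. Qed.

Lemma set_finsetK B : finset_of [set` B] = B.
Proof. by apply/setP => x; rewrite inE asboolb. Qed.

Lemma card_set_finset B : [set` B] #= `I_#|B|.
Proof.
apply/pcard_eqP/bijPex; exists (fun x => index x (enum B)); split.
- by move=> x /= xB; rewrite cardE index_mem mem_enum.
- move=> x y; rewrite !inE /= => xB yB e.
  by have := congr1 (nth x (enum B)) e; rewrite !nth_index ?mem_enum.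
- move=> k /= lt; have [x0 _] : exists x, x \in B.
    by apply/card_gt0P; apply: leq_ltn_trans lt.
  rewrite cardE in lt; exists (nth x0 (enum B) k).
    by rewrite /= -mem_enum mem_nth.
  by rewrite index_uniq ?enum_uniq.
Qed.

Lemma card_eq_finset B k : [set` B] #= `I_k -> #|B| = k.
Proof.
move=> Bk; apply/card_eq_II.
by rewrite -(card_eqr Bk) card_eq_sym card_set_finset.
Qed.

Lemma shatters_finset (F : set (set X)) B :
  shatters F [set` B] <-> shattered [set C : {set X} | `[< F [set` C] >]]%SET B.
Proof.
split=> [sh | /shatteredP sh A /= AB].
  apply/shatteredP => C CB.
  have [|T FT TC] := sh [set` C]; first by move=> x /=; apply: (fintype.subsetP CB).
  exists (finset_of T); first by rewrite inE finset_ofK; apply/asboolP.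
  apply/setP => x; rewrite !inE; apply/andP/idP => [[/asboolP Tx Bx] | Cx].
    by have : [set` C] x by rewrite -TC.
  by have : [set` C] x by []; rewrite -TC => -[Tx Bx]; split=> //; apply/asboolP.
have [|C] := sh (finset_of A).
  by apply/fintype.subsetP => x; rewrite inE => /asboolP/AB.
rewrite inE => /asboolP FC CA; exists [set` C] => //.
rewrite -(finset_ofK A) -CA; apply/seteqP.
by split=> x /=; rewrite inE => /andP.
Qed.

Lemma vcdim_ge (R : realType) (F : set (set X)) B :
  shatters F [set` B] -> (((#|B|)%:R : R)%:E <= vcdim R F)%E.
Proof.
move=> sh; apply: ereal_sup_ubound; exists #|B| => //=.
by exists [set` B] => //; apply: card_set_finset.
Qed.

Lemma vcdim_le (R : realType) (F : set (set X)) d :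
  (forall B, shatters F [set` B] -> (#|B| <= d)%N) ->
  (vcdim R F <= (d%:R : R)%:E)%E.
Proof.
move=> le_d; apply: ge_ereal_sup => _ [k [A Ak sh] <-].
rewrite lee_fin ler_nat; rewrite -(finset_ofK A) in Ak sh.
by rewrite -(card_eq_finset Ak); apply: le_d.
Qed.

(** Sauer-Shelah with [k] the integer part of (d - 2)/3: all shattered sets have at most [k]
    elements, and there are at least as many of them as members of the family. *)
Lemma card_vcdim (R : realType) (F : set (set X)) (d : nat) :
  (vcdim R F <= ((d%:R - 2) / 3)%:E)%E -> F !=set0 ->
  exists2 k, (3 * k + 2 <= d)%N &
    (#|[set B : {set X} | `[< F [set` B] >]]%SET| <= #|X|.+1 ^ k)%N.
Proof.
move=> vc [T FT].
have small B : shatters F [set` B] -> (3 * #|B| + 2 <= d)%N.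
  move=> /(vcdim_ge R)/le_trans/(_ vc); rewrite lee_fin ler_pdivlMr // lerBrDr.
  by rewrite -natrM -natrD ler_nat mulnC.
(* A nonempty family shatters the empty set, so its dimension is at least 0; for the empty family it
   would be [-oo]. *)
have d2 : (2 <= d)%N.
  have := small finset.set0; rewrite cards0; apply=> A A0; exists T => //.
  apply/seteqP; split=> x /=; first by rewrite inE => -[].
  by move/A0; rewrite /= inE.
exists ((d - 2) %/ 3)%N; first by lia.
apply: leq_trans (leq_card_shattered _) _.
apply: leq_trans (card_small_sets _ _).
apply: subset_leq_card; apply/fintype.subsetP => B; rewrite !inE.
by move=> /shatters_finset/small; lia.
Qed.

End FiniteSets.

(** * Families of sets with small pairwise intersections *)

Section Packing.
Variables (X I : finType) (C : I -> {set X}) (r : nat).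
Hypothesis packC : forall i j, (r <= #|C i :&: C j|)%N -> i = j.

Definition indicator (B : {set X}) : hypothesis X := fun x => x \in B.

Definition punctured_class : set (hypothesis X) :=
  [set h | exists i, h = indicator (C i) \/
             exists2 x, x \in C i & h = indicator (C i :\ x)].

(** Suppose [B] has at least [r + 2] points. Its full trace puts [B] inside some [C i]; the trace
    omitting two points [a], [b] comes from a curve sharing at least [r] points with [C i], hence
    from [C i] itself, but one puncture cannot remove two points. *)
Lemma card_shattered_punctured (B : {set X}) :
  shatters (positive_regions punctured_class) [set` B] -> (#|B| <= r.+1)%N.
Proof.
set P := positive_regions _ => /shatters_finset/shatteredP sh.
rewrite leqNgt; apply/negP => ltB.
(* Whole and punctured curves are treated alike, as subsets of a curve that miss at most one of its
   points. *)
have trace (A : {set X}) : A \subset B -> exists i (D : {set X}),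
    [/\ D \subset C i, (#|C i :\: D| <= 1)%N & D :&: B = A].
  move=> /sh[D]; rewrite inE => /asboolP[h [i [->|[x _ ->]]] eD] DA.
    have {}eD : D = C i by rewrite -[C i]set_finsetK -[LHS]set_finsetK -eD.
    by exists i, D; split=> //; rewrite eD ?finset.setDv ?cards0.
  have {}eD : D = C i :\ x.
    by rewrite -[C i :\ x]set_finsetK -[LHS]set_finsetK -eD.
  exists i, D; split=> //; first by rewrite eD finset.subD1set.
  rewrite -(cards1 x); apply: subset_leq_card; apply/fintype.subsetP => y.
  by rewrite eD !inE; case: eqP => //= _; rewrite andNb.
have [i [D [DC _ DB]]] := trace _ (subxx B).
have BC : B \subset C i.
  by rewrite -DB; apply: fintype.subset_trans DC; apply: finset.subsetIl.
have /card_gt1P[a [b [aB bB nab]]] : (1 < #|B|)%N by apply: leq_ltn_trans ltB.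
have [j [E [EC leE EB]]] : exists j (E : {set X}), [/\ E \subset C j,
    (#|C j :\: E| <= 1)%N & E :&: B = B :\ a :\ b].
  by apply: trace; rewrite finset.subDset finset.subDset !finset.setUA finset.subsetUr.
have eji : i = j.
  apply: packC; apply: (@leq_trans #|B :\ a :\ b|).
    by have := cardsD1 a B; have := cardsD1 b (B :\ a);
       rewrite !inE aB bB (eq_sym b) nab /=; lia.
  apply: subset_leq_card; rewrite finset.subsetI; apply/andP; split.
    by apply: fintype.subset_trans BC; rewrite -EB finset.subsetIr.
  by apply: fintype.subset_trans EC; rewrite -EB finset.subsetIl.
have : (1 < #|C j :\: E|)%N.
  apply/card_gt1P; exists a, b; split=> //; rewrite inE.
    rewrite -eji (fintype.subsetP BC) // andbT; apply/negP => aE.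
    by have := finset.in_setI a E B; rewrite EB aE aB !inE eqxx andbF.
  rewrite -eji (fintype.subsetP BC) // andbT; apply/negP => bE.
  by have := finset.in_setI b E B; rewrite EB bE bB !inE eqxx.
by rewrite ltnNge leE.
Qed.
(** Otherwise each [C i] contains a member of [F] with at least [r] points. By packing this member
    determines [i], so [F] would have at least [#|I|] members. *)
Lemma exists_sparse_index (F : set (set X)) :
  (#|[set B : {set X} | `[< F [set` B] >]]%SET| < #|I|)%N ->
  exists i, forall T, F T -> T `<=` [set` C i] -> (#|finset_of T| < r)%N.
Proof.
move=> ltI; apply: contrapT => /forallNP bad; move: ltI; apply/negP; rewrite -leqNgt.
have /choice[T badT] i : exists T,
    [/\ F T, T `<=` [set` C i] & (r <= #|finset_of T|)%N].
  have /existsNP[T /not_implyP[FT /not_implyP[TC /negP]]] := bad i.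
  by rewrite -leqNgt => leT; exists T.
pose f i := finset_of (T i).
have inj_f : injective f.
  move=> i j eT; have [_ TCi leT] := badT i; have [_ TCj _] := badT j.
  apply: packC; apply: leq_trans leT _; apply: subset_leq_card.
  apply/fintype.subsetP => x; rewrite -/(f i) finset.in_setI => xT.
  apply/andP; split; [apply: TCi | apply: TCj].
    by rewrite -(finset_ofK (T i)).
  by rewrite -(finset_ofK (T j)) -/(f j) -eT.
rewrite -(card_imset _ inj_f); apply: subset_leq_card.
apply/fintype.subsetP => _ /imsetP[i _ ->]; rewrite inE finset_ofK; apply/asboolP.
by have [FT _ _] := badT i.
Qed.

End Packing.

(** * How much a query reveals about a puncture *)

Section Adversary.
Variables (X : finType) (B : {set X}) (Q : set (region_query X)) (r : nat).
Variable e : region_query X -> bool.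
Hypothesis goodB : forall T, qdom Q T -> T `<=` [set` B] ->
  (#|finset_of T| <= r)%N.

Local Notation ans D := (answer [set: X] e (indicator D)).

(** For a nonempty region [T] and label [true] the answer says whether [T] lies in the target: it
    can change only if [T] lies in [B] and [x] is in [T], which leaves at most [r] points. For label
    [false] it says whether [T] avoids the target: it changes only if [T] meets [B] in [x] alone. *)
Lemma card_answer_change q : Q q ->
  (#|[set x in B | ans B q != ans (B :\ x) q]%SET| <= r.+1)%N.
Proof.
case: q => T [] QT; have domT : qdom Q T by [exists true | exists false].
- have [TB | nTB] := pselect (T `<=` [set` B]).
    apply: leq_trans (leqW (goodB domT TB)).
    apply: subset_leq_card; apply/fintype.subsetP => x; rewrite !inE.
    case/andP => xB; apply: contra_neqP => nTx.
    rewrite /answer setIT /=; case: ifP => // _; apply: asbool_equiv_eq.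
    split=> h y Ty; have := h y Ty; rewrite /indicator !inE; last by case/andP.
    by move=> ->; rewrite andbT; apply/eqP => eyx; apply: nTx; rewrite -eyx.
  rewrite (_ : [set _ in _ | _]%SET = finset.set0) ?cards0 //.
  apply/setP => x; rewrite !inE; apply/negP => /andP[_ /eqP[]].
  rewrite /answer setIT /=; case: ifP => // _; apply: asbool_equiv_eq.
  split=> h; exfalso; apply: nTB => y Ty; have := h y Ty; rewrite /indicator //.
  by rewrite !inE => /andP[].
- suff hit x : x \in [set x in B | ans B (T, false) != ans (B :\ x) (T, false)]%SET ->
      T `&` [set` B] = [set x].
    apply: (@leq_trans 1) => //; apply/card_le1_eqP => x y /hit Tx /hit.
    by rewrite Tx => /seteqP[/(_ x erefl)].
  rewrite inE => /andP[xB]; apply: contra_neqP => nTx.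
  rewrite /answer setIT /=; case: ifP => // _; apply: asbool_equiv_eq.
  split=> h y Ty; have := h y Ty; rewrite /indicator !inE; first by move=> ->; rewrite andbF.
  case: eqVneq => //= eyx _; apply/negP => _; apply: nTx.
  apply/seteqP; split=> z /=; last by move=> ->; rewrite -[x in T x]eyx.
  by case=> Tz zB; have := h z Tz; rewrite /indicator !inE zB andbT; case: eqVneq.
Qed.

(** A puncture that keeps the answer at the root leads to the same subtree as [B], so the changes
    add up along the run on [B]. *)
Lemma card_predict_change (t : learner Q) :
  (#|[set x in B | `[< predict (ans B) t <> predict (ans (B :\ x)) t >]]%SET|
     <= r.+1 * nqueries (ans B) t)%N.
Proof.
elim: t => [g|q Qq next IH] /=.
  rewrite (_ : [set _ in _ | _]%SET = finset.set0) ?cards0 //.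
  by apply/setP => x; rewrite !inE; apply/negP => /andP[_ /asboolP].
rewrite mulnS; apply: leq_trans (leq_add (card_answer_change Qq) (IH (ans B q))).
apply: leq_trans (leq_card_setU _ _); apply: subset_leq_card.
apply/fintype.subsetP => x; rewrite !inE => /andP[-> /=].
by case: eqVneq => [<-|].
Qed.

(** Punctures that leave the prediction unchanged share one labeling, which is right for at most one
    of them; hence the extra 1. *)
Lemma card_correct (t : learner Q) :
  (#|[set x in B |
       `[< forall y, predict (ans (B :\ x)) t y = indicator (B :\ x) y >]]%SET|
     <= (r.+1 * nqueries (ans B) t).+1)%N.
Proof.
set K := [set _ in _ | _]%SET.
set D := [set x in B | `[< predict (ans B) t <> predict (ans (B :\ x)) t >]]%SET.
rewrite -[K](finset.setID _ D).
apply: leq_trans (leq_card_setU _ _) _; rewrite -addn1; apply: leq_add.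
  apply: leq_trans (card_predict_change t); apply: subset_leq_card.
  exact: finset.subsetIr.
apply/card_le1_eqP => x y; rewrite !inE.
case/andP => nDx /andP[xB /asboolP ex] /andP[nDy /andP[yB /asboolP ey]].
move: nDx nDy; rewrite xB yB /= => /asboolPn/contrapT px /asboolPn/contrapT py.
apply/eqP; have := ey x; rewrite -py px ex /indicator !inE xB eqxx.
by case: eqVneq.
Qed.

End Adversary.

(** Averaging: if every event had probability below 1/3, the expected number of events that occur
    would be below [#|B|] / 3, whereas almost surely at least that many occur. *)
Lemma exists_likely_event (R : realType) (disp : measure_display)
    (Omega : measurableType disp) (P : probability Omega R) (X : finType)
    (B : {set X}) (E : X -> set Omega) :
  (0 < #|B|)%N -> (forall x, x \in B -> measurable (E x)) ->
  {ae P, forall w, (#|B| <= 3 * #|[set x in B | `[< E x w >]]%SET|)%N} ->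
  exists2 x, x \in B & ((3^-1 : R)%:E <= P (E x))%E.
Proof.
move=> B0 mE many; apply: contrapT => /forall2NP few.
(* Measurability is known on [B] only; the empty set extends it to every index. *)
pose E' x := if x \in B then E x else set0.
have mE' x : measurable (E' x) by rewrite /E'; case: ifPn => [/mE|].
have lt3 x : x \in B -> fine (P (E' x)) < 3^-1.
  move=> xB; have [|/negP] := few x; first by rewrite xB.
  rewrite -ltNge -lte_fin fineK ?fin_num_measure //.
  by rewrite /E' xB.
have : \sum_(x in B) fine (P (E' x)) < \sum_(x in B) 3^-1.
  have [x0 xB0] := card_gt0P B0.
  apply: ltr_sum => [|x /lt3 //]; apply/hasP; exists x0 => //.
apply/negP; rewrite -leNgt -lee_fin -[leRHS]sumEFin.
rewrite (eq_bigr (fun x => \int[P]_w (\1_(E' x) w)%:E)%E); last first.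
  by move=> x _; rewrite fineK ?fin_num_measure // integral_indic // setIT.
rewrite -[leRHS]big_enum -ge0_integral_sum //=; last first.
- by move=> x; apply/measurable_EFinP; exact: measurable_indic.
(* As [P] has mass 1, the constant is an integral too, and an almost everywhere comparison of
   integrands remains. *)
rewrite (_ : (\sum_(x in B) 3^-1)%:E = \int[P]_w (cst (\sum_(x in B) 3^-1)%:E w))%E; last first.
  by rewrite integral_cst //= [X in (_ * X)%E]probability_setT mule1.
apply: (@ae_ge0_le_integral _ _ _ P setT) => //.
- by move=> w _; rewrite lee_fin sumr_ge0.
- by move=> w _; apply: sume_ge0 => x _; rewrite lee_fin.
- by apply: emeasurable_sum => x; apply/measurable_EFinP; exact: measurable_indic.
apply: filterS many => w many _.
rewrite sumEFin lee_fin sumr_const big_enum /=.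
rewrite (eq_bigr (fun x => (x \in [set x in B | `[< E x w >]]%SET)%:R)); last first.
  move=> x xB; rewrite indicE !inE /= /E' xB; congr ((nat_of_bool _)%:R).
rewrite -natr_sum (_ : (\sum_(x in B) _)%N = #|[set x in B | `[< E x w >]]%SET|).
  by rewrite -[3^-1 *+ _]mulr_natr ler_pdivrMl // -natrM ler_nat.
rewrite -sum1_card big_mkcond [RHS]big_mkcond; apply: eq_bigr => x _.
by rewrite finset.in_set; case: (x \in B); case: asbool.
Qed.

(** * The VC dimension of the punctured curves *)

Section PolynomialCurves.
Variables (F : finFieldType) (r : nat) (X : finType) (j : F * F -> X).
Hypotheses (inj_j : injective j) (ltrF : (r < #|F|)%N).

(** The upper bound is packing. For the lower bound, [r.+1] points of the horizontal axis are
    shattered: subsets with fewer than [r] points by interpolation, the full set by the zero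
    polynomial, and those with [r] points by puncturing the zero curve. *)
Lemma vcdim_graph (R : realType) :
  vcdim R (positive_regions (punctured_class (@graph F r X j))) = ((r.+1)%:R)%:E.
Proof.
apply/eqP; rewrite eq_le; apply/andP; split.
  apply: vcdim_le => B; apply: card_shattered_punctured; exact: eq_graph.
have [U cardU] : exists U : {set F}, #|U| = r.+1.
  have /card_geqP[s [us szs _]] := ltrF.
  by exists [set u in s]%SET; rewrite cardsE (card_uniqP us).
pose B := [set j (u, 0) | u in U]%SET.
have inj0 : injective (fun u => j (u, 0)) by move=> u v /inj_j[].
have <- : #|B| = r.+1 by rewrite card_imset.
apply: vcdim_ge; apply/shatters_finset/shatteredP => A AB.
have posI (D : {set X}) : punctured_class (@graph F r X j) (indicator D) ->
    D \in [set D : {set X} |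
      `[< positive_regions (punctured_class (@graph F r X j)) [set` D] >]]%SET.
  by move=> hD; rewrite finset.in_set; apply/asboolP; exists (indicator D).
pose V := [set u in U | j (u, 0) \in A]%SET.
have memA u : u \in U -> (j (u, 0) \in A) = (u \in V).
  by move=> Uu; rewrite finset.in_set Uu.
have [ltV | geV] := ltnP #|V| r.
  have [|f [f1 f0]] := exists_graph inj_j (V := U :\: V) ltV.
    rewrite disjoint_sym finset.disjoints_subset; apply/fintype.subsetP => u.
    by rewrite !inE; case/andP.
  exists (graph j f); first by apply: posI; exists f; left.
  apply/setP => x; rewrite finset.in_setI; apply/andP/idP.
    case=> xf /imsetP[u Uu ex]; rewrite ex memA //; apply: contraLR xf => nVu.
    by rewrite ex f0 // finset.in_setD nVu.
  move=> xA; have xB := fintype.subsetP AB _ xA; split=> //.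
  by case/imsetP: xB xA => u Uu ->; rewrite memA // => /f1.
have graph0 u : j (u, 0) \in graph j (0 : 'rV[F]_r).
  by apply/imsetP; exists u => //; rewrite linear0 horner0.
have subB : B \subset graph j (0 : 'rV[F]_r).
  by apply/fintype.subsetP => _ /imsetP[u _ ->].
have [eV | [u0 u0V]] := finset.set_0Vmem (U :\: V).
  exists (graph j (0 : 'rV[F]_r)); first by apply: posI; exists 0; left.
  rewrite (finset.setIidPr subB); apply/eqP; rewrite finset.eqEsubset AB andbT.
  apply/fintype.subsetP => _ /imsetP[u Uu ->]; rewrite memA //.
  by have := finset.in_set0 u; rewrite -eV finset.in_setD Uu andbT => /negbFE.
have [Uu0 nVu0] : u0 \in U /\ u0 \notin V.
  by move: u0V; rewrite finset.in_setD => /andP[].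
exists (graph j (0 : 'rV[F]_r) :\ j (u0, 0)).
  by apply: posI; exists 0; right; exists (j (u0, 0)).
(* [V] has at least [r] of the [r.+1] elements of [U] and misses [u0], so it is [U] without [u0]. *)
have eU u : u \in U -> (u \in V) = (u != u0).
  move=> Uu; apply/idP/idP => [uV | nuu]; first by apply: contraNneq nVu0 => <-.
  apply: contraLR geV => nuV; rewrite -ltnNge.
  have : (V :|: [set u; u0])%SET \subset U.
    apply/fintype.subsetP => v; rewrite !finset.inE => /orP[/andP[]//|].
    by case/orP => /eqP ->.
  move=> /subset_leq_card; rewrite cardU cardsU cards2 nuu.
  rewrite (_ : V :&: _ = finset.set0) ?cards0; first by lia.
  apply/setP => v; rewrite finset.in_setI finset.in_set0 finset.in_set2.
  by apply/negP => /andP[vV /orP[] /eqP ev]; move: vV; rewrite ev; apply/negP.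
apply/setP => x; rewrite finset.in_setI finset.in_setD1.
apply/andP/idP => [[/andP[nx _] /imsetP[u Uu ex]] | xA].
  by rewrite ex memA // eU //; apply: contraNneq nx => <-; rewrite ex.
have xB := fintype.subsetP AB _ xA; split=> //.
rewrite (fintype.subsetP subB) // andbT.
case/imsetP: xB xA => u Uu ->; rewrite memA // eU // => nu.
by rewrite (inj_eq inj0).
Qed.

End PolynomialCurves.

(** The budget on the run for [B] leaves at most two thirds of the punctures correctly labeled, so
    at least a third are errors for almost every seed; averaging then fixes one puncture. *)
Lemma exists_hard_puncture (R : realType) (X : finType) (B : {set X})
    (Q : set (region_query X)) (r : nat) (e : region_query X -> bool)
    (disp : measure_display) (Omega : measurableType disp)
    (P : probability Omega R) (A : Omega -> learner Q) :
  (0 < #|B|)%N ->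
  (forall T, qdom Q T -> T `<=` [set` B] -> (#|finset_of T| <= r)%N) ->
  (forall x, x \in B ->
     measurable (error_event setT setT e A (indicator (B :\ x)))) ->
  {ae P, forall w,
     (3 * (r.+1 * nqueries (answer setT e (indicator B)) (A w)).+1
        <= 2 * #|B|)%N} ->
  exists2 x, x \in B &
    ((3^-1 : R)%:E <= P (error_event setT setT e A (indicator (B :\ x))))%E.
Proof.
move=> B0 goodB mE few.
apply: (@exists_likely_event R disp Omega P X B
  (fun x => error_event setT setT e A (indicator (B :\ x)))) => //.
apply: filterS few => w few.
have := card_correct e goodB (A w).
set K := [set _ in _ | _]%SET; set W := [set _ in _ | _]%SET => leK.
suff : (#|B| <= #|K| + #|W|)%N by lia.
apply: leq_trans (leq_card_setU _ _); apply: subset_leq_card.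
apply/fintype.subsetP => x xB; rewrite finset.in_setU !finset.in_set xB /=.
apply/orP; case: (pselect (error_event setT setT e A (indicator (B :\ x)) w)).
  by move=> err; right; apply/asboolP.
move=> ok; left; apply/asboolP => y; apply: contrapT => ne; apply: ok.
by exists y.
Qed.

Lemma query_budget (d q n m : nat) :
  (18 * d ^ 2 + 4 <= q)%N -> (n < 4 * q ^ 2)%N -> (m ^ 4 < n)%N ->
  (3 * (d * m).+1 <= 2 * q)%N.
Proof.
move=> leq_q ltn ltm.
have lt2q : (m ^ 2 < 2 * q)%N.
  rewrite -(ltn_exp2r _ _ (isT : (0 < 2)%N)) -expnM expnMn; lia.
(* If [m <= 6 * d], the left side is at most [18 * d ^ 2 + 3]. Otherwise
   [6 * d * m < m ^ 2 < 2 * q], so the left side is below [q + 3], and [q >= 4]. *)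
have [le6 | lt6] := leqP m (6 * d); nia.
Qed.

Lemma ltr_powR4 (R : realType) (m n : nat) :
  m%:R < (n%:R : R) `^ 4^-1 -> (m ^ 4 < n)%N.
Proof.
move=> lt; rewrite -(ltr_nat R) natrX.
have -> : (n%:R : R) = (n%:R `^ 4^-1) ^+ 4.
  by rewrite -powR_mulrn ?powR_ge0 // -powRrM mulVf // powRr1.
by rewrite ltr_pXn2r ?nnegrE ?powR_ge0.
Qed.

(** The divisor 3 in (d - 2)/3 comes from here: [n.+1 <= 4 * q ^ 2 <= q ^ 3], and
    [3 * k <= d - 2 < d - 1]. *)
Lemma succn_exp_lt (d q n k : nat) :
  (4 <= q)%N -> (n < 4 * q ^ 2)%N -> (3 * k + 2 <= d)%N ->
  (n.+1 ^ k < q ^ d.-1)%N.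
Proof.
move=> q4 ltn led.
apply: (@leq_ltn_trans ((q ^ 3) ^ k)).
  case: k {led} => [//|k]; rewrite leq_exp2r // expnS.
  by apply: leq_trans ltn _; rewrite leq_mul2r q4 orbT.
by rewrite -expnM ltn_exp2l; lia.
Qed.

(** * Choice of the field, the space and the hard target *)

Theorem theorem1p3 (R : realType) :
  exists c : R, 0 < c /\
  forall d : nat, (0 < d)%N ->
  exists N : nat, forall n : nat, (N <= n)%N -> (d <= n)%N ->
  exists (X : Type) (H : set (hypothesis X)) (S : set X),
    [/\ vcdim R (positive_regions H) = (d%:R)%:E,
        S #= `I_n &
        forall Q : set (region_query X),
          (vcdim R (qdom Q) <= ((d%:R - 2) / 3)%:E)%E ->
        forall (e : region_query X -> bool)
               (disp : measure_display) (Omega : measurableType disp)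
               (P : probability Omega R) (A : Omega -> learner Q),
          (forall h, H h -> measurable (error_event S S e A h)) ->
        exists2 hstar : hypothesis X, H hstar &
          {ae P, forall w,
             (nqueries (answer S e hstar) (A w))%:R < n%:R `^ c} ->
          ((3^-1 : R)%:E <= P (error_event S S e A hstar))%E].
Proof.
exists 4^-1; split; first by rewrite invr_gt0.
(* This threshold makes the base 4 logarithm [m] of [n] at least [18 * d ^ 2 + 4], and the field has
   [2 ^ m > m] elements. *)
move=> d d0; exists (4 ^ (18 * d ^ 2 + 4))%N => n leNn _.
pose m := trunc_log 4 n.
have n0 : (0 < n)%N by apply: leq_trans leNn; rewrite expn_gt0.
have lem : (18 * d ^ 2 + 4 <= m)%N by apply: trunc_log_max.
have [F _ cardF] := pPrimePowerField (isT : prime 2) (ltac:(lia) : (0 < m)%N).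
have q4m : (#|F| ^ 2 = 4 ^ m)%N by rewrite cardF -expnM mulnC expnM.
have leqn : (#|F| ^ 2 <= n)%N by rewrite q4m trunc_logP.
have ltnq : (n < 4 * #|F| ^ 2)%N by rewrite q4m -expnS trunc_log_ltn.
have leF : (18 * d ^ 2 + 4 <= #|F|)%N.
  by rewrite cardF; apply: leq_trans lem _; apply/ltnW/ltn_expl.
have ltdF : (d <= #|F|)%N by apply: leq_trans leF; nia.
(* Padding points on no curve bring the size of the plane up to exactly [n]. *)
pose X : finType := ((F * F) + 'I_(n - #|F| ^ 2))%type.
have cardX : #|X| = n by rewrite card_sum card_prod card_ord mulnn subnKC.
pose r := d.-1; pose j (p : F * F) : X := inl p.
have inj_j : injective j by move=> p p' [].
pose C := @graph F r X j.
exists X, (punctured_class C), setT; split.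
- by rewrite vcdim_graph ?prednK // /r; lia.
- have := card_set_finset (finset.setTfor X); rewrite cardsT cardX.
  rewrite (_ : [set` _] = setT) //.
  by apply/seteqP; split=> x //= _; rewrite finset.in_setT.
move=> Q vcQ e disp Omega P A mE.
have [f sparse] : exists f, forall T, qdom Q T -> T `<=` [set` C f] ->
    (#|finset_of T| < r)%N.
  apply: exists_sparse_index; first exact: eq_graph.
  rewrite card_mx mul1n.
  (* There are [#|F| ^ d.-1] curves; a family without regions is counted directly. *)
  have [Q0 | /nonemptyPn Qn0] := pselect (qdom Q !=set0).
    have [k led leF'] := card_vcdim vcQ Q0.
    apply: leq_ltn_trans leF' _; rewrite cardX; apply: succn_exp_lt ltnq led.
    exact: leq_trans (leq_addl _ _) leF.
  rewrite Qn0 (_ : [set _ | _]%SET = finset.set0) ?cards0.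
    by rewrite expn_gt0 (leq_trans d0 ltdF).
  by apply/setP => D; rewrite finset.in_set finset.in_set0; apply/asboolP.
pose cheap h := {ae P, forall w,
  (nqueries (answer setT e h) (A w))%:R < (n%:R : R) `^ 4^-1}.
(* If the budget is exceeded with target [C f], then [C f] is itself a valid [hstar], the
   implication being vacuous. *)
have [cheapf | ncheap] := pselect (cheap (indicator (C f))); last first.
  by exists (indicator (C f)) => //; exists f; left.
have [x xf err] : exists2 x, x \in C f &
    ((3^-1 : R)%:E <= P (error_event setT setT e A (indicator (C f :\ x))))%E.
  apply: (@exists_hard_puncture R X (C f) Q r).
  - by rewrite card_graph //; lia.
  - by move=> T QT /(sparse T QT)/ltnW.
  - by move=> x xf; apply: mE; exists f; right; exists x.
  - apply: filterS cheapf => w /ltr_powR4 ltm.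
    by rewrite card_graph // prednK //; apply: query_budget ltm.
by exists (indicator (C f :\ x)) => // ; exists f; right; exists x.
Qed.
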